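(* Let $(X,d)$ be a complete linear metric space, let $\{e_n\}\subset X$ be a Schauder basis of $X$, and let $T:X\to X$ be asymptotically contractive. Let $m\in\mathbb{N}$ and let $X_m$ be the subspace of $X$ spanned by $e_1,\dots,e_m$, with the metric $d_{X_m}$ induced by $d$. If the restriction of $T$ to $X_m$, regarded as a self-mapping $T|_{X_m}:X_m\to X_m$, has a fixed point in the metric subspace $(X_m,d_{X_m})$, then that fixed point is necessarily unique and coincides with the (unique) fixed point of $T$ in $X$.
   Context: A linear metric space is a real or complex vector space $X$ with a metric $d$ for which the vector space operations are continuous; $\mathbb{N}=\{1,2,\dots\}$. A sequence $\{e_n\}\subset X$ is a Schauder basis of $X$ if every $x\in X$ has a unique representation $x=\sum_{i=1}^{\infty}x_ie_i$ with scalar coefficients $x_i=x_i(x)$, the series converging in $(X,d)$. A self-mapping $T:X\to X$ is called asymptotically contractive if there are a real constant $K\in[0,1)$ and a sequence of (finite) natural numbers $\{p_n\}$, depending only on $n$, with $\limsup_{n\to\infty}p_n<+\infty$, such that $d(T^nx,T^ny)\le K^{n-p_n}d(T^{p_n}x,T^{p_n}y)$ for all $x,y\in X$ and all $n\in\mathbb{N}$ (if $K=0$, the inequality is required only for those $n$ with $n\ge p_n$). Here $T^n$ denotes the $n$-fold composition of $T$ with itself. *)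

(* Defs.v *)
From HB Require Import structures.
From mathcomp Require Import all_boot all_order all_algebra.
From mathcomp Require Import complex.
From mathcomp Require Import all_classical all_reals all_analysis.

Set Implicit Arguments.
Unset Strict Implicit.
Unset Printing Implicit Defensive.

Import Order.TTheory GRing.Theory Num.Theory.
Import numFieldNormedType.Exports.

Local Open Scope classical_set_scope.
Local Open Scope ring_scope.

Variant real_or_complex := RealScalars | ComplexScalars.

Definition scalars (R : realType) (s : real_or_complex) : numFieldType :=
  match s with RealScalars => R | ComplexScalars => R[i] end.

(* The metric is real-valued whatever the scalars are, hence the two
   parameters. It is not assumed to be translation invariant. The topology for
   which the operations of X are continuous is the one induced by the metric
   (nbhs_ldist). This does not extend the library's metricType: no structure
   of the library joins PseudoMetric and Zmodule below
   PseudoMetricNormedZmod. *)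
HB.mixin Record TopologicalLmodule_isLinearMetric (R : realType)
    (K : numFieldType) X & TopologicalLmodule K X := {
  ldist : X -> X -> R ;
  ldistxx : forall x, ldist x x = 0 ;
  ldist_positivity : forall x y, ldist x y = 0 -> x = y ;
  ldist_sym : forall x y, ldist x y = ldist y x ;
  ldist_triangle : forall y x z, ldist x z <= ldist x y + ldist y z ;
  nbhs_ldist : forall x : X, nbhs x =
    filter_from [set r : R | 0 < r] (fun r => [set y | ldist x y < r])
}.

#[short(type="linearMetricType")]
HB.structure Definition LinearMetric (R : realType) (K : numFieldType) :=
  {X of TopologicalLmodule K X & TopologicalLmodule_isLinearMetric R K X}.

Definition complete_linear_metric (R : realType) (K : numFieldType)
    (X : linearMetricType R K) : Prop :=
  forall u : nat -> X,
    (forall r : R, 0 < r -> exists N : nat, forall i j : nat,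
       (N <= i)%N -> (N <= j)%N -> ldist (u i) (u j) < r) ->
    exists l : X, u @ \oo --> l.

(* Bases are indexed from 0: the vector e_(i+1) of the usual numbering is
   [e i]. *)
Definition schauder_basis (R : realType) (K : numFieldType)
    (X : linearMetricType R K) (e : nat -> X) : Prop :=
  forall x : X, exists! c : nat -> K,
    series (fun i => c i *: e i) @ \oo --> x.

(* [k ^ _] is the power with an integer exponent, which may be negative when
   k > 0; if k = 0, then 0 ^ 0 = 1. Only the indices n >= 1 matter. *)
Definition asymptotically_contractive (R : realType)
    (K : numFieldType) (X : linearMetricType R K) (T : X -> X) : Prop :=
  exists (k : R) (p : nat -> nat),
    [/\ 0 <= k < 1,
        forall n, (0 < n)%N -> (0 < p n)%N,
        (limn_esup (fun n => (p n)%:R%:E : \bar R) < +oo)%E &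
        forall n, (0 < n)%N -> (k = 0 -> (p n <= n)%N) ->
          forall x y : X,
            ldist (iter n T x) (iter n T y) <=
            k ^ (n%:Z - (p n)%:Z) * ldist (iter (p n) T x) (iter (p n) T y)].

Definition span_first (K : numFieldType) (X : lmodType K) (e : nat -> X)
    (m : nat) : set X :=
  [set x | exists c : 'I_m -> K, x = \sum_(i < m) c i *: e i].

(* [set_type A] is not used: its canonical topology is not syntactically the
   one built from the induced metric. *)
Definition metric_subspace (R : realType) (K : numFieldType)
    (X : linearMetricType R K) (A : set X) : Type := {x : X | x \in A}.

Section MetricSubspace.
Context (R : realType) (K : numFieldType) (X : linearMetricType R K)
  (A : set X).

HB.instance Definition _ := [isSub of metric_subspace A for @sval _ _].
HB.instance Definition _ := [Choice of metric_subspace A by <:].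

Let d (u v : metric_subspace A) : R := ldist (val u) (val v).

Let dxx u : d u u = 0.
Proof. exact: ldistxx. Qed.

Let d_positivity u v : d u v = 0 -> u = v.
Proof. by move=> /ldist_positivity /val_inj. Qed.

Let d_sym u v : d u v = d v u.
Proof. exact: ldist_sym. Qed.

Let d_triangle v u w : d u w <= d u v + d v w.
Proof. exact: ldist_triangle. Qed.

HB.instance Definition _ := isMetric.Build R (metric_subspace A)
  dxx d_positivity d_sym d_triangle.

Lemma metric_subspace_mdistE (u v : metric_subspace A) :
  mdist u v = ldist (val u) (val v).
Proof. by []. Qed.

Lemma restriction_subproof (T : X -> X) (TA : set_fun A A T)
  (u : metric_subspace A) : T (val u) \in A.
Proof. by apply/mem_set/TA/set_mem/(valP u). Qed.

Definition restriction (T : X -> X) (TA : set_fun A A T)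
  (u : metric_subspace A) : metric_subspace A :=
  Sub (T (val u)) (restriction_subproof TA u).

End MetricSubspace.

Definition fixed_point (X : Type) (f : X -> X) (x : X) : Prop := f x = x.

(* Main.v *)
Require Import Defs.
From HB Require Import structures.
From mathcomp Require Import all_boot all_order all_algebra.
From mathcomp Require Import all_classical all_reals all_analysis.

Set Implicit Arguments.
Unset Strict Implicit.
Unset Printing Implicit Defensive.

(** Fixed points of [T] are fixed points of every iterate of [T]. Since the
    sequence [p] has a finite limit superior, it is eventually bounded, so some
    index [n] satisfies [p n < n]; for two fixed points [x] and [y] the
    contraction inequality at that [n] reads
    [ldist x y <= k ^ (n - p n) * ldist x y] with [k ^ (n - p n) < 1], which
    forces [ldist x y = 0] ([asymptotically_contractive_fixed_point_unique]).
    A fixed point of the restriction of [T] to a subset is a fixed point of [T]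
    itself, so this single uniqueness result settles both the subspace and the
    whole space; existence in the whole space is witnessed by the given fixed
    point of the restriction. *)

Import Order.TTheory GRing.Theory Num.Theory.

Local Open Scope classical_set_scope.
Local Open Scope ring_scope.

(** A limit superior below +oo is the infimum of the suprema over the
    neighborhoods of infinity, so one of these suprema is below +oo. *)
Lemma limn_esup_nat_bounded (R : realType) (p : nat -> nat) :
  (limn_esup (fun n => (p n)%:R%:E : \bar R) < +oo)%E ->
  exists M : nat, \forall n \near \oo, (p n <= M)%N.
Proof.
case/ereal_inf_lt => _ [V nearV <-] supV.
have [b bP] : exists b : R,
    (ereal_sup [set ((p n)%:R%:E : \bar R) | n in V] <= b%:E)%E.
  case: (ereal_sup _) supV => [b| |] // _; first by exists b.
  by exists 0; rewrite leNye.
exists (Num.truncn b); apply: filterS nearV => n Vn.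
rewrite -ltnS -(ltr_nat R); apply: le_lt_trans (truncnS_gt b).
by rewrite -lee_fin; apply: le_trans bP; apply: ereal_sup_ubound; exists n.
Qed.

Section FixedPoints.
Context (R : realType) (K : numFieldType) (X : linearMetricType R K).

Lemma ldist_ge0 (x y : X) : 0 <= ldist x y.
Proof.
have := ldist_triangle y x x.
by rewrite ldistxx (ldist_sym y x) -mulr2n pmulrn_lge0.
Qed.

(** An index [n] with [p n < n] makes the exponent [n - p n] a positive
    natural number, so the power of [k] is below 1 even for [k = 0], where
    exponent 0 would give 1. *)
Lemma asymptotically_contractive_fixed_point_unique (T : X -> X) :
  asymptotically_contractive T ->
  forall x y, fixed_point T x -> fixed_point T y -> x = y.
Proof.
move=> [k [p [/andP[k0 k1] _ /limn_esup_nat_bounded[M [N _ pM]] Tk]]] x y Tx Ty.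
have iterT n u : fixed_point T u -> iter n T u = u.
  by move=> Tu; elim: n => //= n ->.
pose n := (maxn M N).+1.
have pn : (p n < n)%N.
  by rewrite ltnS (leq_trans (pM n _)) ?leq_maxl//= leqW// leq_maxr.
have := Tk n isT (fun=> ltnW pn) x y.
rewrite !iterT// subzn 1?ltnW// -exprnP => dk.
apply: ldist_positivity; apply/eqP; rewrite eq_le ldist_ge0 andbT leNgt.
apply/negP => d0; move: dk; rewrite leNgt gtr_pMl//.
by rewrite exprn_ilt1// -lt0n subn_gt0 pn.
Qed.

Lemma fixed_point_restriction (A : set X) (T : X -> X) (TA : set_fun A A T)
    (u : metric_subspace A) :
  fixed_point (restriction TA) u -> fixed_point T (val u).
Proof. by move=> /(congr1 val). Qed.

End FixedPoints.

Theorem proposition2p3 (R : realType) (s : real_or_complex)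
    (X : linearMetricType R (scalars R s)) (hX : complete_linear_metric X)
    (e : nat -> X) (he : schauder_basis e)
    (T : X -> X) (hT : asymptotically_contractive T)
    (m : nat) (hm : (0 < m)%N)
    (hTm : set_fun (span_first e m) (span_first e m) T)
    (z : metric_subspace (span_first e m))
    (hz : fixed_point (restriction hTm) z) :
  unique (fixed_point (restriction hTm)) z /\
  unique (fixed_point T) (val z).
Proof.
have fixT := asymptotically_contractive_fixed_point_unique hT.
have Tz := fixed_point_restriction hz.
split; split=> //.
  by move=> w /fixed_point_restriction Tw; apply/val_inj/fixT.
by move=> x Tx; apply: fixT.
Qed.
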